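(* Let $\alpha>1$. Then there exist a dictionary $\mathcal D$ of $\mathbb R^2$ (with the Euclidean inner product) and an element $f\in A_1(\mathcal D)$ such that the approximants $(\mathcal T_m^r(f))_{m\ge 1}$ produced by the Power-Relaxed Greedy Algorithm with parameter $\alpha$ applied to $f$ satisfy $$\inf_{m\ge 1}\|f-\mathcal T_m^r(f)\|>0 .$$
   Context: Let $\mathbb H$ be a real Hilbert space with inner product $\langle\cdot,\cdot\rangle$ and induced norm $\|\cdot\|$. A dictionary $\mathcal D\subset\mathbb H$ is a set such that $\|g\|=1$ for every $g\in\mathcal D$, $-g\in\mathcal D$ whenever $g\in\mathcal D$, and the linear span of $\mathcal D$ is dense in $\mathbb H$. The class $A_1(\mathcal D)$ is the closure in $\mathbb H$ of the set of all $f=\sum_{k\in\Lambda}a_kg_k$ with $\Lambda$ a finite index set, $g_k\in\mathcal D$, $a_k$ scalars, and $\sum_{k\in\Lambda}|a_k|\le 1$. For $h\in\mathbb H$, $g(h)\in\mathcal D$ denotes an element of $\mathcal D$ maximizing $\langle h,g\rangle$ over $g\in\mathcal D$ (such a maximizer is assumed to exist; if there are several, any one may be chosen). Power-Relaxed Greedy Algorithm (PRGA) with parameter $\alpha>0$: set $\mathcal T_0^r(f):=0$ and $\mathcal R_0^r(f):=f$. For $m=1$, set $\mathcal T_1^r(f):=\langle f,g(f)\rangle\,g(f)$ and $\mathcal R_1^r(f):=f-\mathcal T_1^r(f)$. For $m\ge 2$, set $$\mathcal T_m^r(f):=\Bigl(1-\frac1{m^\alpha}\Bigr)\mathcal T_{m-1}^r(f)+\frac1{m^\alpha}\,g\bigl(\mathcal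 R_{m-1}^r(f)\bigr),\qquad \mathcal R_m^r(f):=f-\mathcal T_m^r(f).$$ *)

(* Defs.v *)
From HB Require Import structures.
From mathcomp Require Import all_boot all_order all_algebra.
From mathcomp Require Import all_classical all_reals all_analysis.

Set Implicit Arguments.
Unset Strict Implicit.
Unset Printing Implicit Defensive.

Import Order.TTheory GRing.Theory Num.Theory.
Import numFieldNormedType.Exports.

Local Open Scope classical_set_scope.
Local Open Scope ring_scope.

Section Euclidean.
Context {R : realType} {n : nat}.
Implicit Types u v h : 'rV[R]_n.

Definition edot u v : R := \sum_i u 0 i * v 0 i.

(* The library norm `|u| on row vectors is the sup norm, not this one. *)
Definition enorm u : R := Num.sqrt (edot u u).

(* By these two bounds the library topology on 'rV[R]_n, used by [closure] and
   [dense] below, is the one induced by [enorm]. *)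
Lemma mx_norm_le_enorm u : `|u| <= enorm u.
Proof.
have dot_ge0 : 0 <= edot u u by apply: sumr_ge0 => i _; rewrite -expr2 sqr_ge0.
rewrite /Num.norm/= mx_normrE; apply: bigmax_le => [|[i j] _ /=]; first exact: sqrtr_ge0.
rewrite (ord1 i) -sqrtr_sqr ler_sqrt// /edot (bigD1 j)//= expr2.
by rewrite lerDl sumr_ge0// => k _; rewrite -expr2 sqr_ge0.
Qed.

Lemma enorm_le_mx_norm u : enorm u <= Num.sqrt n%:R * `|u|.
Proof.
rewrite -[X in _ * X]ger0_norm// -sqrtr_sqr -sqrtrM// ler_wsqrtr//.
apply: (@le_trans _ _ (\sum_(i < n) `|u| ^+ 2)).
  apply: ler_sum => i _; rewrite -expr2 -real_normK ?num_real// lerXn2r//.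
    by rewrite nnegrE.
  rewrite {2}/Num.norm/= mx_normrE.
  exact: (le_bigmax _ (fun ij : 'I_1 * 'I_n => `|u ij.1 ij.2|) (0, i)).
by rewrite sumr_const card_ord mulr_natl.
Qed.

Definition lin_span (D : set 'rV[R]_n) : set 'rV[R]_n :=
  [set f | exists (k : nat) (a : 'I_k -> R) (g : 'I_k -> 'rV[R]_n),
     (forall i, D (g i)) /\ f = \sum_i a i *: g i].

Definition dictionary (D : set 'rV[R]_n) : Prop :=
  [/\ forall g, D g -> enorm g = 1,
      forall g, D g -> D (- g) &
      dense (lin_span D)].

Definition A1 (D : set 'rV[R]_n) : set 'rV[R]_n :=
  closure [set f | exists (k : nat) (a : 'I_k -> R) (g : 'I_k -> 'rV[R]_n),
     [/\ forall i, D (g i), \sum_i `|a i| <= 1 & f = \sum_i a i *: g i]].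

Definition is_greedy (D : set 'rV[R]_n) h (g : 'rV[R]_n) : Prop :=
  D g /\ forall g', D g' -> edot h g' <= edot h g.

(* [g m] is the dictionary element picked from the [m]-th residual, that is,
   g(R_m(f)); [prga_choice] below says that it is an admissible pick. *)
Fixpoint prga (alpha : R) (f : 'rV[R]_n) (g : nat -> 'rV[R]_n) (m : nat)
    : 'rV[R]_n :=
  match m with
  | 0 => 0
  | 1 => edot f (g 0%N) *: g 0%N
  | m'.+1 => (1 - (m%:R `^ alpha)^-1) *: prga alpha f g m'
             + (m%:R `^ alpha)^-1 *: g m'
  end.

Definition prga_residual alpha f g m := f - prga alpha f g m.

Definition prga_choice (D : set 'rV[R]_n) alpha f g : Prop :=
  forall m, is_greedy D (prga_residual alpha f g m) (g m).

End Euclidean.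

(* Main.v *)
Require Import Defs.
From mathcomp Require Import all_boot all_order all_algebra.
From mathcomp Require Import all_classical all_reals all_analysis.
From mathcomp Require Import lra.
Import Order.TTheory GRing.Theory Num.Theory.
Import numFieldNormedType.Exports.
Local Open Scope classical_set_scope.
Local Open Scope ring_scope.

(** Take for D the signed unit vectors of the plane, f = (1/2, 1/2), and let F
    be the sum of the coordinates, so that F <= 1 on D and F(f) = 1.  Then
    1 - F(T_1) = 1/2, and the m-th relaxation step multiplies the defect
    1 - F(T_(m-1)) by at least 1 - m^-alpha, whatever element of D is picked.
    Since the series of the m^-alpha converges, the product of these factors
    stays away from 0, and so does F(f - T_m). *)

Section PowerEstimates.
Context {R : realType}.
Implicit Types (x a b : R) (n : nat).

(** After inversion this reads [(1 - x)^-1 <= expR (2 * x)]; the value [1 + 2 * x] lies in between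
    because [x * (1 - 2 * x) >= 0]. *)
Lemma expR_le_subr1 x : 0 <= x <= 2^-1 -> expR (- (2 * x)) <= 1 - x.
Proof.
move=> /andP[x0 x2]; have x1 : 0 < 1 - x by lra.
rewrite expRN -[leRHS]invrK lef_pV2 ?posrE ?expR_gt0 ?invr_gt0//.
apply: le_trans (expR_ge1Dx _).
by rewrite -[leLHS]mul1r ler_pdivrMr//; nra.
Qed.

(** Factor out the power of [n.+2] with exponent [- b] and put q = n.+1 / n.+2. What remains follows
    from q^(-b) >= 1 - b ln q and ln q <= q - 1 = -1 / n.+2, both instances of 1 + t <= exp t. *)
Lemma powRN_telescope b n : 0 < b ->
  b * n.+2%:R `^ (- (1 + b)) <= n.+1%:R `^ (- b) - n.+2%:R `^ (- b).
Proof.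
move=> b0; have n2 : 0 < n.+2%:R :> R by rewrite ltr0n.
have n1 : 0 < n.+1%:R :> R by rewrite ltr0n.
have -> : n.+2%:R `^ (- (1 + b)) = n.+2%:R^-1 * n.+2%:R `^ (- b) :> R.
  rewrite opprD powRD ?(gt_eqF n2) ?implybT//.
  by rewrite powR_inv1 ?ler0n.
have -> : n.+1%:R `^ (- b) = (n.+1%:R / n.+2%:R) `^ (- b) * n.+2%:R `^ (- b) :> R.
  by rewrite -powRM ?divr_ge0 ?ler0n// divfK// gt_eqF.
rewrite mulrA -{3}[n.+2%:R `^ _]mul1r -mulrBl ler_wpM2r ?powR_ge0//.
have q0 : 0 < n.+1%:R / n.+2%:R :> R by rewrite divr_gt0.
rewrite /powR gt_eqF// lerBrDl; apply: le_trans (expR_ge1Dx _).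
rewrite lerD2l mulNr -mulrN ler_wpM2l ?(ltW b0)// lerNr.
have -> : - n.+2%:R^-1 = n.+1%:R / n.+2%:R - 1 :> R.
  by rewrite -[n.+1%:R](addrK 1) natr1 mulrBl divff ?gt_eqF// mul1r addrAC subrr
    sub0r.
by rewrite lerBrDl; apply: le_trans (expR_ge1Dx _) _; rewrite lnK ?posrE.
Qed.

Lemma invr_powR_le_half a n : 1 <= a -> (n.+2%:R `^ a)^-1 <= 2^-1 :> R.
Proof.
move=> a1; rewrite lef_pV2 ?posrE ?powR_gt0 ?ltr0n//.
apply: (@le_trans _ _ (n.+2%:R `^ 1)); first by rewrite powRr1// ler_nat.
by rewrite ler_powR// ler1n.
Qed.

(* [n |-> expR (2 / b * (n `^ - b - 1))] is a subsolution, equal to [1] at [n = 1]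
   and bounded below, of the recurrence [u n = (1 - n `^ - (1 + b)) * u (n - 1)]. *)
Lemma expR_powR_step b n : 0 < b ->
  expR (2 / b * (n.+2%:R `^ (- b) - 1)) <=
  (1 - (n.+2%:R `^ (1 + b))^-1) * expR (2 / b * (n.+1%:R `^ (- b) - 1)).
Proof.
move=> b0; set x := (_ `^ (1 + b))^-1.
have x2 : 0 <= x <= 2^-1.
  by rewrite invr_ge0 powR_ge0/= invr_powR_le_half// lerDl ltW.
apply: le_trans (ler_wpM2r (expR_ge0 _) (expR_le_subr1 _ x2)).
rewrite -expRD ler_expR.
have := powRN_telescope b n b0; rewrite powRN -/x.
(* The factor [2 / b] turns the [b * x] of the telescoping bound into the [2 * x] of
   [expR_le_subr1]. *)
rewrite -(ler_pM2l (_ : 0 < 2 / b)) ?divr_gt0// mulrA divfK ?gt_eqF//.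
by rewrite !mulrBr; lra.
Qed.

Lemma relaxation_lower_bound a (u : nat -> R) : 1 < a -> 0 <= u 1%N ->
  (forall n, (1 - (n.+2%:R `^ a)^-1) * u n.+1 <= u n.+2) ->
  forall n, expR (- (2 / (a - 1))) * u 1%N <= u n.+1.
Proof.
move=> a1 u1 ustep n; set b := a - 1; have b0 : 0 < b by rewrite subr_gt0.
have ab : a = 1 + b by rewrite addrC subrK.
(* The induction needs the bound that depends on [n]; dropping its nonnegative power of [n.+1]
   leaves the uniform one. *)
apply: (@le_trans _ _ (expR (2 / b * (n.+1%:R `^ (- b) - 1)) * u 1%N)).
  rewrite ler_wpM2r// ler_expR mulrBr mulr1 lerDr.
  by rewrite mulr_ge0 ?powR_ge0// divr_ge0// ltW.
elim: n => [|n IHn]; first by rewrite powR1 subrr mulr0 expR0 mul1r.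
apply: le_trans (ustep n); rewrite ab.
apply: le_trans (ler_wpM2r u1 (expR_powR_step b n b0)) _.
rewrite -[leLHS]mulrA; apply: ler_wpM2l IHn; rewrite subr_ge0.
by have := invr_powR_le_half (1 + b) n; rewrite lerDl (ltW b0) => /(_ isT); lra.
Qed.

End PowerEstimates.

Section SignedBasis.
Context {R : realType} {n : nat}.
Implicit Types (u v h g : 'rV[R]_n) (i : 'I_n).

Definition signed_basis : set 'rV[R]_n :=
  [set g | exists (b : bool) i, g = (-1) ^+ b *: delta_mx 0 i].

Lemma edotDr h u v : edot h (u + v) = edot h u + edot h v.
Proof.
by rewrite /edot -big_split; apply: eq_bigr => i _; rewrite mxE mulrDr.
Qed.

Lemma edotZr h (a : R) u : edot h (a *: u) = a * edot h u.
Proof.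
by rewrite /edot mulr_sumr; apply: eq_bigr => i _; rewrite mxE mulrCA.
Qed.

Lemma edot_signed h (b : bool) i :
  edot h ((-1) ^+ b *: delta_mx 0 i) = (-1) ^+ b * h 0 i.
Proof.
rewrite edotZr /edot (bigD1 i)//= big1 ?addr0 => [|j ji].
  by rewrite mxE !eqxx mulr1.
by rewrite mxE (negbTE ji) andbF mulr0.
Qed.

(** Each coordinate is at most the Euclidean norm; the crude factor [n], instead of its square root,
    is enough for a positive lower bound. *)
Lemma edot_const_le_enorm u : edot (const_mx 1) u <= n%:R * enorm u.
Proof.
rewrite mulr_natl -[X in _ *+ X]card_ord -sumr_const; apply: ler_sum => i _.
rewrite mxE mul1r (le_trans (ler_norm _))// -sqrtr_sqr ler_wsqrtr//.
by rewrite /edot (bigD1 i)//= expr2 lerDl sumr_ge0// => j _; rewrite -expr2 sqr_ge0.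
Qed.

Lemma dictionary_signed_basis : dictionary signed_basis.
Proof.
split=> [g [b [i ->]]|g [b [i ->]]|].
- by rewrite /enorm edot_signed mxE mxE !eqxx mulr1 -expr2 sqrr_sign sqrtr1.
- by exists (~~ b), i; rewrite -scaleNr signrN.
(* The span is the whole space, so any point of the open set will do. *)
- move=> O [u Ou] _; exists u; split=> //.
  exists n, (u 0), (delta_mx 0); split; last exact: row_sum_delta.
  by move=> i; exists false, i; rewrite scale1r.
Qed.

Lemma A1_signed_basis u : \sum_i `|u 0 i| <= 1 -> A1 signed_basis u.
Proof.
move=> u1; apply: subset_closure; exists n, (u 0), (delta_mx 0).
split=> //; last exact: row_sum_delta.
by move=> i; exists false, i; rewrite scale1r.
Qed.

(** A maximizer is the coordinate vector of an entry of largest absolute value, carrying the sign of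
    that entry; [i0] makes the index set nonempty. *)
Lemma greedy_signed_basis (i0 : 'I_n) h : exists g, is_greedy signed_basis h g.
Proof.
have [i _ hi] := @Order.TotalTheory.arg_maxP _ _ _ i0 xpredT (fun i => `|h 0 i|) isT.
exists ((-1) ^+ (h 0 i < 0)%R *: delta_mx 0 i); split; first by exists (h 0 i < 0)%R, i.
move=> _ [b [j ->]]; rewrite !edot_signed -normrEsign.
apply: le_trans (hi j isT).
by rewrite (le_trans (ler_norm _))// normrM normr_sign mul1r.
Qed.

Lemma edot_const_signed_basis g : signed_basis g -> edot (const_mx 1) g <= 1.
Proof.
by move=> [b [i ->]]; rewrite edot_signed mxE mulr1 (le_trans (ler_norm _))// normr_sign.
Qed.

(** With F = [edot (const_mx 1)] and relaxation weight w, the new defect is (1 - w)(1 - F(T)) + w (1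
    - F(g)), whose last term is nonnegative. *)
Lemma prga_defect_step alpha f (g : nat -> 'rV[R]_n) m :
  (forall k, signed_basis (g k)) ->
  (1 - (m.+2%:R `^ alpha)^-1) * (1 - edot (const_mx 1) (prga alpha f g m.+1)) <=
  1 - edot (const_mx 1) (prga alpha f g m.+2).
Proof.
move=> Dg; rewrite [prga _ _ _ m.+2]/= -/(prga alpha f g m.+1) edotDr !edotZr.
have w0 : 0 <= (m.+2%:R `^ alpha)^-1 by rewrite invr_ge0 powR_ge0.
by have := edot_const_signed_basis _ (Dg m.+1); nra.
Qed.

End SignedBasis.

Theorem theorem2p4 (R : realType) (alpha : R) (alpha_gt1 : 1 < alpha) :
  exists (D : set 'rV[R]_2) (f : 'rV[R]_2),
    [/\ dictionary D,
        forall h : 'rV[R]_2, exists g : 'rV[R]_2, is_greedy D h g,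
        A1 D f &
        forall g : nat -> 'rV[R]_2, prga_choice D alpha f g ->
          0 < inf [set enorm (f - prga alpha f g m) |
                     m in [set m : nat | (1 <= m)%N]]].
Proof.
exists signed_basis, (const_mx 2^-1); split.
- exact: dictionary_signed_basis.
- exact: greedy_signed_basis ord0.
- by apply: A1_signed_basis; rewrite !big_ord_recl big_ord0 !mxE ger0_norm//; lra.
move=> g gP; set f : 'rV[R]_2 := const_mx _ in gP *.
have Dg k : signed_basis (g k) by have [] := gP k.
pose u m := 1 - edot (const_mx 1) (prga alpha f g m).
(* The first step projects [f] onto the line of [g 0], so the sign of [g 0] cancels and F(T_1) is a
   coordinate of [f]. *)
have u1 : u 1%N = 2^-1.
  have [b [i g0]] := Dg 0%N.
  rewrite /u /= edotZr g0 !edot_signed !mxE mulr1 mulrAC -expr2 sqrr_sign.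
  by lra.
(* Since F(f) = 1, the defect is F(f - T_m); the constant 2 is the dimension. *)
have ule m : u m <= 2 * enorm (f - prga alpha f g m).
  apply: le_trans (edot_const_le_enorm _).
  rewrite /u edotDr -[- prga _ _ _ _]scaleN1r edotZr mulN1r lerD2r.
  by rewrite /edot !big_ord_recl big_ord0 !mxE; lra.
apply: (@lt_le_trans _ _ (expR (- (2 / (alpha - 1))) * u 1%N / 2)).
  by rewrite u1 !mulr_gt0 ?expR_gt0.
apply: lb_le_inf; first by exists (enorm (f - prga alpha f g 1)), 1%N.
move=> _ [[//|m] _ <-]; rewrite ler_pdivrMr// mulrC.
rewrite [leRHS]mulrC; apply: le_trans (ule _); rewrite mulrC.
apply: relaxation_lower_bound => //; first by rewrite u1.
by move=> k; apply: prga_defect_step.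
Qed.
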